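(* Let (A3) denote the statement that the system $(\ast)$ of the context admits a unique solution $(\bar x,l,\bar s,\varphi,v)$ in $C([0,T],\mathbb R^{5n})$. If the Riccati differential equation $$\dot Y=M_{21}+M_{22}Y-YM_{11}-YM_{12}Y,\qquad Y(T)=\begin{pmatrix}0&0&H^T\\ 0&0&0\end{pmatrix}^T$$ admits a solution $Y\in\mathbb R^{3n\times2n}$ on $[0,T]$, then (A3) holds. Furthermore, under the assumption $\bar\eta=0$, if the Riccati differential equation $$\dot Z=M_{12}+M_{11}Z-ZM_{22}-ZM_{21}Z,\qquad Z(0)=0$$ admits a solution $Z\in\mathbb R^{2n\times3n}$ on $[0,T]$, then (A3) holds.
   Context: **Data.** $T>0$; $A,G,\Gamma\in\mathbb R^{n\times n}$, $B\in\mathbb R^{n\times r}$, $\eta,\bar x_0\in\mathbb R^n$; symmetric $Q\ge0$, $R_2>0$, $H\ge0$ in $\mathbb R^{n\times n}$ and $R_1>0$ in $\mathbb R^{r\times r}$. $\Psi=\Gamma^TQ+Q\Gamma-\Gamma^TQ\Gamma$, $\bar\eta=Q\eta-\Gamma^TQ\eta$. $P\in C([0,T],\mathbb R^{n\times n})$ is the solution (assumed to exist on $[0,T]$) of $$\dot P+(A+G)^TP+P(A+G)-P R_2^{-1}P-(I-\Gamma)^TQ(I-\Gamma)=0,\quad P(T)=-H,$$ and $K$ is the solution of $\dot K+A^TK+KA-KBR_1^{-1}B^TK+Q=0$, $K(T)=H$. $\bar G=G-R_2^{-1}P$, $\bar A=A-BR_1^{-1}B^TK$ (functions of $t$). **System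 $(\ast)$:** $$\begin{aligned} \dot{\bar x}&=(\bar A+\bar G)\bar x+BR_1^{-1}B^T(Pl-\varphi)-R_2^{-1}\bar s,\ \ \bar x(0)=\bar x_0,\\ \dot l&=(A+\bar G)l+R_2^{-1}v+R_2^{-1}(P\bar x+\bar s),\ \ l(0)=0,\\ \dot{\bar s}&=-(A+\bar G)^T\bar s+PBR_1^{-1}B^T(K\bar x-Pl+\varphi)-\bar\eta,\ \ \bar s(T)=0,\\ \dot\varphi&=-\bar A^T\varphi-KBR_1^{-1}B^TPl-K\bar G\bar x+KR_2^{-1}\bar s+\Psi\bar x+\bar\eta+P R_2^{-1}(P\bar x+\bar s)-\bar G^Tv,\ \ \varphi(T)=0,\\ \dot v&=-(A+\bar G)^Tv+(\Psi-Q)\bar x+\bar\eta+P R_2^{-1}(P\bar x+\bar s),\ \ v(T)=H\bar x(T). \end{aligned}$$ **Block coefficients.** $M_{11},M_{12},M_{21},M_{22}$ are the coefficient blocks of $(\ast)$ when it is written as $\dot m=M_{11}m+M_{12}z$, $\dot z=M_{21}m+M_{22}z+(-\bar\eta^T,\bar\eta^T,\bar\eta^T)^T$ with $m=(\bar x^T,l^T)^T$, $z=(\bar s^T,\varphi^T,v^T)^T$, i.e. $$M_{11}=\begin{pmatrix}\bar A+\bar G & BR_1^{-1}B^TP \\ R_2^{-1}P & A+\bar G\end{pmatrix},\quad M_{12}=\begin{pmatrix}-R_2^{-1} & -BR_1^{-1}B^T & 0 \\ R_2^{-1} & 0 & R_2^{-1}\end{pmatrix},$$ $$M_{21}=\begin{pmatrix}PBR_1^{-1}B^TK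 & -PBR_1^{-1}B^TP \\ -K\bar G+\Psi+P R_2^{-1}P & -KBR_1^{-1}B^TP \\ \Psi-Q+P R_2^{-1}P & 0\end{pmatrix},\quad M_{22}=\begin{pmatrix}-(A+\bar G)^T & PBR_1^{-1}B^T & 0 \\ (K+P)R_2^{-1} & -\bar A^T & -\bar G^T \\ P R_2^{-1} & 0 & -(A+\bar G)^T\end{pmatrix}.$$ *)

(* Defs.v *)
From HB Require Import structures.
From mathcomp Require Import all_boot all_order all_algebra.
From mathcomp Require Import all_classical all_reals all_analysis.

Set Implicit Arguments.
Unset Strict Implicit.
Unset Printing Implicit Defensive.

Import Order.TTheory GRing.Theory Num.Theory.
Import numFieldNormedType.Exports.

Local Open Scope classical_set_scope.
Local Open Scope ring_scope.

Definition psdmx (R : realType) (k : nat) (S : 'M[R]_k) : Prop :=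
  S^T = S /\ forall u : 'cV[R]_k, 0 <= (u^T *m S *m u) 0 0.

Definition pdmx (R : realType) (k : nat) (S : 'M[R]_k) : Prop :=
  S^T = S /\ forall u : 'cV[R]_k, u != 0 -> 0 < (u^T *m S *m u) 0 0.

(* [f] is continuous on [0, T] and has derivative [f' t] at every [t] of the
   closed interval [0, T]; the difference quotients only use points of [0, T],
   so the derivative is one-sided at [0] and at [T], and the values of [f]
   outside [0, T] play no role. *)
Definition has_deriv_on (R : realType) (V : normedModType R)
    (T : R) (f f' : R -> V) : Prop :=
  {within `[0, T], continuous f} /\
  forall t, t \in `[0, T] ->
    (s - t)^-1 *: (f s - f t) @[s --> within [set` `[0, T]] t^'] --> f' t.

Record coefs (R : realType) (n r : nat) := Coefs {
  coefA : 'M[R]_n;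
  coefG : 'M[R]_n;
  coefGamma : 'M[R]_n;
  coefB : 'M[R]_(n, r);
  coefQ : 'M[R]_n;
  coefR1 : 'M[R]_r;
  coefR2 : 'M[R]_n;
  coefH : 'M[R]_n;
  coefeta : 'cV[R]_n;
  coefx0 : 'cV[R]_n
}.

Section System.
Context (R : realType) (n r : nat) (d : coefs R n r) (T : R).

Local Notation A := (coefA d).
Local Notation G := (coefG d).
Local Notation Gamma := (coefGamma d).
Local Notation B := (coefB d).
Local Notation Q := (coefQ d).
Local Notation H := (coefH d).
Local Notation eta := (coefeta d).
Local Notation x0 := (coefx0 d).
Local Notation R1i := (invmx (coefR1 d)).
Local Notation R2i := (invmx (coefR2 d)).

Definition Psi : 'M[R]_n := Gamma^T *m Q + Q *m Gamma - Gamma^T *m Q *m Gamma.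

Definition etabar : 'cV[R]_n := Q *m eta - Gamma^T *m Q *m eta.

Definition solves_P (P : R -> 'M[R]_n) : Prop :=
  has_deriv_on T P (fun t =>
    - ((A + G)^T *m P t + P t *m (A + G) - P t *m R2i *m P t
       - (1%:M - Gamma)^T *m Q *m (1%:M - Gamma))) /\
  P T = - H.

Definition solves_K (K : R -> 'M[R]_n) : Prop :=
  has_deriv_on T K (fun t =>
    - (A^T *m K t + K t *m A - K t *m B *m R1i *m B^T *m K t + Q)) /\
  K T = H.

Context (P K : R -> 'M[R]_n).

Definition Gbar (t : R) : 'M[R]_n := G - R2i *m P t.

Definition Abar (t : R) : 'M[R]_n := A - B *m R1i *m B^T *m K t.

Definition solves_star (x l s phi v : R -> 'cV[R]_n) : Prop :=
  [/\ has_deriv_on T x (fun t =>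
        (Abar t + Gbar t) *m x t
        + B *m R1i *m B^T *m (P t *m l t - phi t) - R2i *m s t)
      /\ x 0 = x0,
      has_deriv_on T l (fun t =>
        (A + Gbar t) *m l t + R2i *m v t + R2i *m (P t *m x t + s t))
      /\ l 0 = 0,
      has_deriv_on T s (fun t =>
        - (A + Gbar t)^T *m s t
        + P t *m B *m R1i *m B^T *m (K t *m x t - P t *m l t + phi t)
        - etabar)
      /\ s T = 0,
      has_deriv_on T phi (fun t =>
        - (Abar t)^T *m phi t - K t *m B *m R1i *m B^T *m P t *m l t
        - K t *m Gbar t *m x t + K t *m R2i *m s t + Psi *m x t + etabar
        + P t *m R2i *m (P t *m x t + s t) - (Gbar t)^T *m v t)
      /\ phi T = 0
    & has_deriv_on T v (fun t =>
        - (A + Gbar t)^T *m v t + (Psi - Q) *m x t + etabar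
        + P t *m R2i *m (P t *m x t + s t))
      /\ v T = H *m x T].

(* Functions are total on R, so uniqueness means agreement on [0, T]. *)
Definition A3 : Prop :=
  (exists x l s phi v, solves_star x l s phi v) /\
  forall x l s phi v x' l' s' phi' v',
    solves_star x l s phi v -> solves_star x' l' s' phi' v' ->
    forall t, t \in `[0, T] ->
      [/\ x t = x' t, l t = l' t, s t = s' t, phi t = phi' t & v t = v' t].

Definition M11 (t : R) : 'M[R]_(n + n, n + n) :=
  block_mx (Abar t + Gbar t) (B *m R1i *m B^T *m P t)
           (R2i *m P t)      (A + Gbar t).

Definition M12 (t : R) : 'M[R]_(n + n, n + n + n) :=
  col_mx (row_mx (row_mx (- R2i) (- (B *m R1i *m B^T))) 0)
         (row_mx (row_mx R2i     0)                     R2i).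

Definition M21 (t : R) : 'M[R]_(n + n + n, n + n) :=
  col_mx
    (col_mx
      (row_mx (P t *m B *m R1i *m B^T *m K t)
              (- (P t *m B *m R1i *m B^T *m P t)))
      (row_mx (- (K t *m Gbar t) + Psi + P t *m R2i *m P t)
              (- (K t *m B *m R1i *m B^T *m P t))))
    (row_mx (Psi - Q + P t *m R2i *m P t) 0).

Definition M22 (t : R) : 'M[R]_(n + n + n, n + n + n) :=
  col_mx
    (col_mx
      (row_mx (row_mx (- (A + Gbar t)^T) (P t *m B *m R1i *m B^T)) 0)
      (row_mx (row_mx ((K t + P t) *m R2i) (- (Abar t)^T)) (- (Gbar t)^T)))
    (row_mx (row_mx (P t *m R2i) 0) (- (A + Gbar t)^T)).

Definition solves_Y (Y : R -> 'M[R]_(n + n + n, n + n)) : Prop :=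
  has_deriv_on T Y (fun t =>
    M21 t + M22 t *m Y t - Y t *m M11 t - Y t *m M12 t *m Y t) /\
  Y T = (col_mx (row_mx (row_mx 0 0) H^T)
                (row_mx (row_mx 0 0) 0) : 'M[R]_(n + n, n + n + n))^T.

Definition solves_Z (Z : R -> 'M[R]_(n + n, n + n + n)) : Prop :=
  has_deriv_on T Z (fun t =>
    M12 t + M11 t *m Z t - Z t *m M22 t - Z t *m M21 t *m Z t) /\
  Z 0 = 0.

End System.

(* Main.v *)
(* Put p := v, b := B R1^-1 B^T and Qt := (I - Gamma)^T Q (I - Gamma) = Q - Psi.
   Along any solution of the system, v + P x + s solves a homogeneous linear
   equation with zero final value, hence vanishes; then so does l, and then, by
   the equation of K, so does K x + phi - v.  The system thus collapses to
   s = -(P x + p), l = 0, phi = p - K x and the two-point problem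
     x' = (A + G) x - (b - R2^-1) p,      x(0) = x0,
     p' = -(A + G)^T p - Qt x + etabar,   p(T) = H x(T).
   A homogeneous solution of this problem is the critical point of a quadratic
   form that is convex in the control and, because P exists on [0, T], concave
   in the disturbance: with d' = (A + G) d + R2^-1 p, d(0) = 0, the derivative of
   -x.p + 2 d.p + d.Pd is the sum of squares
     |x - d|^2_Qt + |B^T p|^2_{R1^-1} + |p + P d|^2_{R2^-1},
   while the function goes from 0 to -|(x - d)(T)|^2_H; so all terms vanish and
   x = p = 0.  Uniqueness makes the shooting matrix invertible, which gives
   existence. *)

Require Import Defs.
From mathcomp Require Import all_boot all_order all_algebra.
From mathcomp Require Import all_classical all_reals all_analysis.
From mathcomp Require Import ring lra.

Set Implicit Arguments.
Unset Strict Implicit.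
Unset Printing Implicit Defensive.

Import Order.TTheory GRing.Theory Num.Theory.
Import numFieldNormedType.Exports.

Local Open Scope classical_set_scope.
Local Open Scope ring_scope.

(** * Limits of matrices, entry by entry *)

Lemma filter_fin_forall (X : Type) (F : set_system X) (I : finType)
    (P : I -> set X) : Filter F ->
  (forall i, F (P i)) -> F [set x | forall i, P i x].
Proof.
move=> FF FP; have FPs (s : seq I) : F [set x | forall i, i \in s -> P i x].
  elim: s => [|i s IH]; first by apply: filterS filterT.
  apply: filterS2 (FP i) IH => x Pix Psx j.
  by rewrite inE => /predU1P[->|/Psx].
by apply: filterS (FPs (enum I)) => x Px i; apply: Px; rewrite mem_enum.
Qed.

(** Matrix neighborhoods are generated by boxes with one side per entry, and there are finitely many
    entries. This reduces matrix calculus to scalar calculus. *)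
Lemma cvg_mxP (R : realType) (X : Type) (F : set_system X) (m n : nat)
    (f : X -> 'M[R]_(m, n)) (M : 'M[R]_(m, n)) : Filter F ->
  f x @[x --> F] --> M <-> forall i j, f x i j @[x --> F] --> (M i j : R).
Proof.
move=> FF; split=> [fM i j A MA|fM A [P MP sPA]].
  apply: (fM [set N | A (N i j)]).
  (* This box constrains the entry [(i, j)] only; its other sides are the whole line. *)
  exists (fun i' j' => [set a | (i' == i) && (j' == j) -> A a]).
    move=> i' j'; case: (boolP ((i' == i) && (j' == j))) => [|_].
      by move=> /andP[/eqP-> /eqP->]; apply: filterS MA => a Aa _.
    by apply: filterS filterT.
  by move=> N /(_ i j); rewrite !eqxx; apply.
have FP : F [set x | forall ij : 'I_m * 'I_n, P ij.1 ij.2 (f x ij.1 ij.2)].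
  by apply: filter_fin_forall => -[i j]; apply: (fM i j); apply: MP.
suff : F (f @^-1` A) by [].
by apply: filterS FP => x Px; apply: sPA => i j; exact: (Px (i, j)).
Qed.

(** * Scalar derivatives relative to a closed interval *)

Section ScalarDerivative.
Context (R : realType) (T : R).
Local Notation D := (@has_deriv_on R R^o T).

Lemma has_deriv_on_cvg (f f' : R -> R) t : D f f' -> t \in `[0, T] ->
  f s @[s --> within [set` `[0, T]] t^'] --> f t.
Proof.
move=> [fc _] tT.
apply: cvg_trans ((@subspace_continuousP _ _ _ _).1 fc t tT).
by apply: cvg_fmap2 => A; exact: nbhs_dnbhs.
Qed.

Lemma has_deriv_on_cst (c : R) : D (fun=> c) (fun=> 0).
Proof.
split=> [|t tT]; first by move=> x; apply: cvg_cst.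
under eq_fun do rewrite subrr scaler0.
exact: cvg_cst.
Qed.

Lemma has_deriv_onD (f f' g g' : R -> R) : D f f' -> D g g' ->
  D (fun t => f t + g t) (fun t => f' t + g' t).
Proof.
move=> [fc fd] [gc gd]; split=> [x|t tT].
  by apply: cvgD; [exact: fc|exact: gc].
rewrite (_ : (fun s => _) = fun s =>
    (s - t)^-1 *: (f s - f t) + (s - t)^-1 *: (g s - g t)).
  by apply: cvgD; [exact: fd|exact: gd].
by apply/funext => s; rewrite /GRing.scale /=; ring.
Qed.

Lemma has_deriv_onM (f f' g g' : R -> R) : D f f' -> D g g' ->
  D (fun t => f t * g t) (fun t => f' t * g t + f t * g' t).
Proof.
move=> Df Dg; have [fc fd] := Df; have [gc gd] := Dg; split=> [x|t tT].
  by apply: (@cvgM R); [exact: fc|exact: gc].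
rewrite (_ : (fun s => _) = fun s =>
    (s - t)^-1 *: (f s - f t) * g s + f t * ((s - t)^-1 *: (g s - g t))).
  apply: cvgD; first by apply: (@cvgM R); [exact: fd|exact: (has_deriv_on_cvg Dg tT)].
  by apply: (@cvgM R); [exact: cvg_cst|exact: gd].
by apply/funext => s; rewrite /GRing.scale /=; ring.
Qed.

Lemma has_deriv_on_sum (I : Type) (r : seq I) (f f' : I -> R -> R) :
  (forall i, D (f i) (f' i)) ->
  D (fun t => \sum_(i <- r) f i t) (fun t => \sum_(i <- r) f' i t).
Proof.
move=> Df; elim: r => [|i r IH].
  rewrite (_ : (fun t => _) = fun=> 0); last by apply/funext => t; rewrite big_nil.
  rewrite [X in D _ X](_ : (fun t => _) = fun=> 0);
    last by apply/funext => t; rewrite big_nil.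
  exact: has_deriv_on_cst.
rewrite (_ : (fun t => _) = fun t => f i t + \sum_(i <- r) f i t);
  last by apply/funext => t; rewrite big_cons.
rewrite [X in D _ X](_ : (fun t => _) = fun t => f' i t + \sum_(i <- r) f' i t);
  last by apply/funext => t; rewrite big_cons.
exact: has_deriv_onD.
Qed.

(** Bridges two conventions: [is_derive] takes a limit in the increment [h] at 0, [has_deriv_on] one
    in the point [s] at [t]. *)
Lemma dnbhs_shift (t : R) : (fun h => h + t) @ 0^' = t^'.
Proof.
rewrite funeqE => A; rewrite propeqE.
change (nbhs (0 : R) (fun h => h != 0 -> A (h + t)) <->
        nbhs t (fun x => x != t -> A x)).
have := @near_shift R R 0 t (fun x => x != t -> A x).
rewrite /prop_near1 => ->.
split; apply: filterS => h /=; rewrite subr0.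
  by move=> + ht; apply; apply: contra ht => /eqP->; rewrite add0r.
by move=> + h0; apply; rewrite -subr_eq0 addrK.
Qed.

Lemma diff_quotient_shift (f : R -> R) (t : R) :
  h^-1 *: ((f \o shift t) (h *: (1 : R)) - f t) @[h --> 0^'] =
  (s - t)^-1 *: (f s - f t : R^o) @[s --> t^'].
Proof.
rewrite -dnbhs_shift; apply/funext => A; congr (nbhs _ _).
by apply/funext => h /=; rewrite addrK /GRing.scale /= mulr1.
Qed.

Lemma is_derive_has_deriv_on (f f' : R -> R) :
  (forall t, is_derive t (1 : R) f (f' t)) -> D f f'.
Proof.
move=> Df; split=> [|t tT].
  apply: continuous_subspaceT => t.
  by apply: differentiable_continuous; apply/derivable1_diffP; case: (Df t).
have [dft ft] := Df t.
have : h^-1 *: ((f \o shift t) (h *: 1) - f t) @[h --> 0^'] --> f' t.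
  by rewrite -ft; exact: dft.
rewrite diff_quotient_shift; exact: cvg_within_filter.
Qed.

(** Around an interior point the interval is a neighborhood, so restricting the filter to it changes
    nothing. *)
Lemma has_deriv_on_is_derive (f f' : R -> R) t : D f f' -> t \in `]0, T[ ->
  is_derive t (1 : R) f (f' t).
Proof.
move=> [_ Df] tT.
have tT' : t \in `[0, T] by apply: subset_itv_oo_cc tT.
suff : h^-1 *: ((f \o shift t) (h *: 1) - f t) @[h --> 0^'] --> f' t.
  by move=> H; split; [apply/cvg_ex; exists (f' t)|apply: cvg_lim].
rewrite diff_quotient_shift; apply: cvg_trans (Df t tT').
apply: cvg_fmap2 => A tA.
have tI : nbhs t (fun s => s \in `]0, T[) by apply: near_in_itvoo.
have {}tA : nbhs t (fun s : R => s != t -> s \in `[0, T] -> A s) by exact: tA.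
suff : nbhs t (fun s : R => s != t -> A s) by [].
apply: filterS2 tI tA => s sT sA st.
by apply: sA => //; apply: subset_itv_oo_cc sT.
Qed.

End ScalarDerivative.

(** * Monotonicity and a Gronwall estimate *)

Section Monotone.
Context (R : realType) (T : R).
Local Notation D := (@has_deriv_on R R^o T).

Lemma has_deriv_on_ge0_le (f f' : R -> R) : D f f' ->
  (forall t, t \in `]0, T[ -> 0 <= f' t) ->
  forall x y, x \in `[0, T] -> y \in `[0, T] -> x <= y -> f x <= f y.
Proof.
move=> Df f'0 x y xT yT xy.
apply: (@ger0_derive1_le_cc R f 0 T) => // [t tT|t tT|].
- by have [] := has_deriv_on_is_derive Df tT.
- have [_ ft] := has_deriv_on_is_derive Df tT.
  by rewrite derive1E ft; exact: f'0.
- by case: Df.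
Qed.

Lemma has_deriv_on_expR (c : R) :
  D (fun t => expR (c * t)) (fun t => c * expR (c * t)).
Proof.
apply: is_derive_has_deriv_on => t.
apply: is_derive_eq.
by rewrite /GRing.scale /=; ring.
Qed.

Lemma has_deriv_on_bounded (f f' : R -> R) : 0 <= T -> D f f' ->
  exists2 M, 0 <= M & forall t, t \in `[0, T] -> `|f t| <= M.
Proof.
move=> T0 [fc _].
have [c cT cM] : exists2 c, c \in `[0, T] & forall t, t \in `[0, T] -> `|f t| <= `|f c|.
  apply: EVT_max => // x.
  by apply: (@cvg_norm R R^o); exact: fc.
by exists `|f c|.
Qed.

(* Gronwall's argument: for the energy e = \sum_i (u i)^2 one has |e'| <= L e,
   hence e t * expR (- L * t) decreases and e t * expR (L * t) increases. *)
Lemma linear_ineq_zero (I : finType) (u u' : I -> R -> R) (C a : R) :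
  (forall i, D (u i) (u' i)) -> 0 <= C ->
  (forall i t, t \in `]0, T[ -> `|u' i t| <= C * \sum_j `|u j t|) ->
  a \in `[0, T] -> (forall i, u i a = 0) ->
  forall i t, t \in `[0, T] -> u i t = 0.
Proof.
move=> Du C0 uC aT ua i t tT.
pose e s := \sum_i u i s * u i s.
pose e' s := \sum_i (u' i s * u i s + u i s * u' i s).
have De : D e e' by apply: has_deriv_on_sum => j; exact: has_deriv_onM.
have e_ge0 s : 0 <= e s by apply: sumr_ge0 => j _; rewrite -expr2 sqr_ge0.
have ea : e a = 0 by apply: big1 => j _; rewrite ua mulr0.
(* With [S] the sum of all [|u j|], this constant comes from [|e'| <= 2 C S^2] and
   [S^2 <= #|I| e]. *)
pose L := C * (#|I|%:R + #|I|%:R).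
have eL s : s \in `]0, T[ -> `|e' s| <= L * e s.
  move=> sT; pose S := \sum_j `|u j s|.
  have S0 : 0 <= S by exact: sumr_ge0.
  (* Cauchy-Schwarz against the all-ones vector, by summing [2 |u k| |u j| <= (u k)^2 + (u j)^2]
     over all pairs. *)
  have SS : S * S <= #|I|%:R * e s.
    have SE : S * S = \sum_i \sum_j `|u i s| * `|u j s| by rewrite big_distrlr.
    suff : S * S + S * S <= #|I|%:R * e s + #|I|%:R * e s by rewrite -!mulr2n ler_pMn2r.
    have -> : #|I|%:R * e s + #|I|%:R * e s =
        \sum_i \sum_j (u i s * u i s + u j s * u j s).
      transitivity (\sum_i (#|I|%:R * (u i s * u i s) + e s)).
        by rewrite big_split /= -mulr_sumr sumr_const mulr_natl.
      by apply: eq_bigr => k _; rewrite big_split /= sumr_const mulr_natl.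
    rewrite SE -big_split; apply: ler_sum => k _.
    rewrite -big_split; apply: ler_sum => j _ /=.
    have := sqr_ge0 (`|u k s| - `|u j s|).
    have sq x : x * x = `|x| * `|x| :> R by rewrite -normrM ger0_norm// -expr2 sqr_ge0.
    by rewrite (sq (u k s)) (sq (u j s)); lra.
  rewrite /e'; apply: le_trans (ler_norm_sum _ _ _) _.
  have : \sum_i (C * S * `|u i s| + C * S * `|u i s|) <= L * e s.
    rewrite big_split /= -mulr_sumr -/S /L -!mulrA -mulrDr.
    by rewrite ler_wpM2l// mulrDl lerD.
  apply: le_trans; apply: ler_sum => k _; apply: le_trans (ler_normD _ _) _.
  rewrite !normrM [`|u k s| * _]mulrC.
  by apply: lerD; apply: ler_wpM2r => //; exact: uC.
have et0 : e t <= 0.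
  have mono (c : R) : D (fun s => e s * expR (c * s))
      (fun s => (e' s + c * e s) * expR (c * s)).
    have := has_deriv_onM De (has_deriv_on_expR c).
    by congr has_deriv_on; apply/funext => s; ring.
  have [at_|ta] := leP a t.
    (* The factor [-1] turns the decreasing function [e t * expR (- L * t)] into one with
       nonnegative derivative. *)
    have := has_deriv_onM (has_deriv_on_cst T (-1)) (mono (- L)).
    move=> /has_deriv_on_ge0_le/(_ _ a t aT tT at_).
    rewrite ea mul0r mulr0 mulN1r oppr_ge0 pmulr_lle0 ?expR_gt0//.
    apply=> s sT; rewrite mul0r add0r mulN1r oppr_ge0 pmulr_lle0 ?expR_gt0//.
    by have := eL s sT; rewrite ler_norml => /andP[_]; lra.
  have := has_deriv_on_ge0_le (mono L) _ tT aT (ltW ta).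
  rewrite ea mul0r pmulr_lle0 ?expR_gt0//; apply => s sT.
  rewrite pmulr_lge0 ?expR_gt0//.
  by have := eL s sT; rewrite ler_norml => /andP[+ _]; lra.
have /eqP : e t = 0 by apply/eqP; rewrite eq_le et0 e_ge0.
rewrite psumr_eq0 => [/allP/(_ i)|j _]; last by rewrite -expr2 sqr_ge0.
by rewrite mem_index_enum mulf_eq0 orbb => /(_ isT)/eqP.
Qed.
End Monotone.

(** * Matrix-valued derivatives and uniqueness for linear equations *)

Section MatrixDerivative.
Context (R : realType) (T : R).

Lemma has_deriv_on_eqr (V : normedModType R) (f f' g' : R -> V) :
  (forall t, t \in `[0, T] -> f' t = g' t) ->
  has_deriv_on T f f' -> has_deriv_on T f g'.
Proof. by move=> fg [fc fd]; split=> // t tT; rewrite -fg//; exact: fd. Qed.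

Lemma has_deriv_on_mxP (m n : nat) (f f' : R -> 'M[R]_(m, n)) :
  has_deriv_on T f f' <->
  forall i j, @has_deriv_on R R^o T (fun t => f t i j) (fun t => f' t i j).
Proof.
have q_entry t s i j :
    ((s - t)^-1 *: (f s - f t)) i j = (s - t)^-1 *: (f s i j - f t i j : R^o).
  by rewrite !mxE.
split=> [[fc fd] i j|fij].
  split=> [x|t tT]; first by have /cvg_mxP := fc x; apply.
  under eq_fun do rewrite -q_entry.
  by have /cvg_mxP := fd t tT; apply.
split=> [x|t tT]; apply/cvg_mxP => i j; first by case: (fij i j) => + _; apply.
under eq_fun do rewrite q_entry.
by case: (fij i j) => _; apply.
Qed.

Lemma has_deriv_on_cstmx (m n : nat) (A : 'M[R]_(m, n)) :
  has_deriv_on T (fun=> A) (fun=> 0).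
Proof.
apply/has_deriv_on_mxP => i j; under [X in has_deriv_on _ _ X]eq_fun do rewrite mxE.
exact: has_deriv_on_cst.
Qed.

Lemma has_deriv_on_addmx (m n : nat) (f f' g g' : R -> 'M[R]_(m, n)) :
  has_deriv_on T f f' -> has_deriv_on T g g' ->
  has_deriv_on T (fun t => f t + g t) (fun t => f' t + g' t).
Proof.
move=> /has_deriv_on_mxP Df /has_deriv_on_mxP Dg; apply/has_deriv_on_mxP => i j.
under eq_fun do rewrite mxE; under [X in has_deriv_on _ _ X]eq_fun do rewrite mxE.
exact: has_deriv_onD.
Qed.

Lemma has_deriv_on_mulmx (m n p : nat) (f f' : R -> 'M[R]_(m, n))
    (g g' : R -> 'M[R]_(n, p)) :
  has_deriv_on T f f' -> has_deriv_on T g g' ->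
  has_deriv_on T (fun t => f t *m g t) (fun t => f' t *m g t + f t *m g' t).
Proof.
move=> /has_deriv_on_mxP Df /has_deriv_on_mxP Dg; apply/has_deriv_on_mxP => i j.
under eq_fun do rewrite mxE.
under [X in has_deriv_on _ _ X]eq_fun do rewrite !mxE -big_split /=.
by apply: has_deriv_on_sum => k; exact: has_deriv_onM.
Qed.

Lemma has_deriv_on_mulmxl (m n p : nat) (A : 'M[R]_(m, n))
    (g g' : R -> 'M[R]_(n, p)) : has_deriv_on T g g' ->
  has_deriv_on T (fun t => A *m g t) (fun t => A *m g' t).
Proof.
move=> Dg; apply: has_deriv_on_eqr (has_deriv_on_mulmx (has_deriv_on_cstmx A) Dg).
by move=> t _; rewrite mul0mx add0r.
Qed.

Lemma has_deriv_on_mulmxr (m n p : nat) (f f' : R -> 'M[R]_(m, n))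
    (A : 'M[R]_(n, p)) : has_deriv_on T f f' ->
  has_deriv_on T (fun t => f t *m A) (fun t => f' t *m A).
Proof.
move=> Df; apply: has_deriv_on_eqr (has_deriv_on_mulmx Df (has_deriv_on_cstmx A)).
by move=> t _; rewrite mulmx0 addr0.
Qed.

Lemma has_deriv_on_oppmx (m n : nat) (f f' : R -> 'M[R]_(m, n)) :
  has_deriv_on T f f' -> has_deriv_on T (fun t => - f t) (fun t => - f' t).
Proof.
move=> /(has_deriv_on_mulmxl (- 1%:M)).
by under eq_fun do rewrite mulNmx mul1mx;
   under [X in has_deriv_on _ _ X]eq_fun do rewrite mulNmx mul1mx.
Qed.

Lemma has_deriv_on_submx (m n : nat) (f f' g g' : R -> 'M[R]_(m, n)) :
  has_deriv_on T f f' -> has_deriv_on T g g' ->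
  has_deriv_on T (fun t => f t - g t) (fun t => f' t - g' t).
Proof. by move=> Df /has_deriv_on_oppmx; exact: has_deriv_on_addmx. Qed.

Lemma has_deriv_on_trmx (m n : nat) (f f' : R -> 'M[R]_(m, n)) :
  has_deriv_on T f f' -> has_deriv_on T (fun t => (f t)^T) (fun t => (f' t)^T).
Proof.
move=> /has_deriv_on_mxP Df; apply/has_deriv_on_mxP => i j.
by under eq_fun do rewrite mxE; under [X in has_deriv_on _ _ X]eq_fun do rewrite mxE.
Qed.

Lemma has_deriv_on_usubmx (m1 m2 n : nat) (f f' : R -> 'M[R]_(m1 + m2, n)) :
  has_deriv_on T f f' -> has_deriv_on T (fun t => usubmx (f t)) (fun t => usubmx (f' t)).
Proof.
move=> /has_deriv_on_mxP Df; apply/has_deriv_on_mxP => i j.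
by under eq_fun do rewrite mxE; under [X in has_deriv_on _ _ X]eq_fun do rewrite mxE.
Qed.

Lemma has_deriv_on_dsubmx (m1 m2 n : nat) (f f' : R -> 'M[R]_(m1 + m2, n)) :
  has_deriv_on T f f' -> has_deriv_on T (fun t => dsubmx (f t)) (fun t => dsubmx (f' t)).
Proof.
move=> /has_deriv_on_mxP Df; apply/has_deriv_on_mxP => i j.
by under eq_fun do rewrite mxE; under [X in has_deriv_on _ _ X]eq_fun do rewrite mxE.
Qed.

Lemma has_deriv_on_mx_bounded (m n : nat) (L L' : R -> 'M[R]_(m, n)) :
  0 <= T -> has_deriv_on T L L' ->
  exists2 M, 0 <= M & forall t i j, t \in `[0, T] -> `|L t i j| <= M.
Proof.
move=> T0 /has_deriv_on_mxP DL.
have /choice [M ML] : forall ij : 'I_m * 'I_n, exists M, 0 <= M /\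
    forall t, t \in `[0, T] -> `|L t ij.1 ij.2| <= M.
  by move=> ij; have [M] := has_deriv_on_bounded T0 (DL ij.1 ij.2); exists M.
exists (\sum_ij M ij) => [|t i j tT]; first by apply: sumr_ge0 => ij _; case: (ML ij).
have [_ /(_ t tT)/le_trans] := ML (i, j); apply.
by rewrite (bigD1 (i, j))//= lerDl sumr_ge0// => ij _; case: (ML ij).
Qed.

(** The coefficients are continuous, hence bounded on [0, T] by [M1] and [M2], so each entry of [w']
    is at most [M1 + M2] times the sum of all [|w i j|] and the Gronwall estimate applies. The base
    point [a] may be either end of the interval, and the two-sided form covers differences of
    Riccati solutions. *)
Lemma linear_ode_zero (m n : nat) (w w' : R -> 'M[R]_(m, n))
    (L1 L1' : R -> 'M[R]_m) (L2 L2' : R -> 'M[R]_n) (a : R) :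
  has_deriv_on T L1 L1' -> has_deriv_on T L2 L2' -> has_deriv_on T w w' ->
  (forall t, t \in `]0, T[ -> w' t = L1 t *m w t + w t *m L2 t) ->
  a \in `[0, T] -> w a = 0 -> forall t, t \in `[0, T] -> w t = 0.
Proof.
move=> DL1 DL2 Dw ww aT wa t tT.
have T0 : 0 <= T by move: aT; rewrite in_itv /= => /andP[]; exact: le_trans.
have [M1 M10 L1M] := has_deriv_on_mx_bounded T0 DL1.
have [M2 M20 L2M] := has_deriv_on_mx_bounded T0 DL2.
apply/matrixP => i j; rewrite [RHS]mxE.
have /has_deriv_on_mxP Dwij := Dw.
apply: (@linear_ineq_zero R T _ (fun ij : 'I_m * 'I_n => fun s => w s ij.1 ij.2)
  (fun ij s => w' s ij.1 ij.2) (M1 + M2) a _ _ _ aT _ (i, j)) => //.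
- exact: addr_ge0.
- move=> [{}i {}j] s sT /=; rewrite ww// !mxE mulrDl.
  have {}sT : s \in `[0, T] by exact: subset_itv_oo_cc sT.
  have S_pair : \sum_(ij : 'I_m * 'I_n) `|w s ij.1 ij.2| = \sum_i \sum_j `|w s i j|.
    by rewrite pair_big.
  apply: le_trans (ler_normD _ _) (lerD _ _);
      apply: le_trans (ler_norm_sum _ _ _) _; rewrite S_pair mulr_sumr.
    apply: ler_sum => k _; rewrite normrM; apply: ler_pM => //; first exact: L1M.
    by rewrite (bigD1 j)//= lerDl sumr_ge0.
  rewrite -mulr_sumr exchange_big /= mulr_sumr.
  apply: ler_sum => k _; rewrite normrM mulrC; apply: ler_pM => //; first exact: L2M.
  by rewrite (bigD1 i)//= lerDl sumr_ge0.
- by move=> ij; rewrite wa mxE.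
Qed.

End MatrixDerivative.

(** * The matrix exponential as a power series *)

Section MatrixExponential.
Context (R : realType).

(** Comparison with [b] times the exponential series at [a * |x|]. *)
Lemma pseries_exp_bound_cvg (c : R^nat) (a b x : R) : 0 <= a -> 0 <= b ->
  (forall k, `|c k| <= b * a ^+ k / k`!%:R) -> cvgn (pseries c x).
Proof.
move=> a0 b0 cab; apply: normed_cvg.
apply: (@series_le_cvg R _ (fun k => b * exp_coeff (a * `|x|) k)).
- by move=> k; exact: normr_ge0.
- by move=> k; apply: mulr_ge0 => //; apply: exp_coeff_ge0; exact: mulr_ge0.
- move=> k; rewrite /= normrM normrX /exp_coeff /= exprMn.
  have := ler_wpM2r (exprn_ge0 k (normr_ge0 x)) (cab k).
  by move/le_trans; apply; rewrite -!mulrA ler_wpM2l// ler_wpM2l ?exprn_ge0// mulrC.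
- exact/is_cvg_seriesZ/is_cvg_series_exp_coeff.
Qed.

(** The factor [k + 1] produced by differentiation cancels against the factorial, so the bound keeps
    its shape and can be iterated. *)
Lemma pseries_diffs_exp_bound (c : R^nat) (a b : R) :
  (forall k, `|c k| <= b * a ^+ k / k`!%:R) ->
  forall k, `|pseries_diffs c k| <= (b * a) * a ^+ k / k`!%:R.
Proof.
move=> cab k; rewrite /pseries_diffs normrM ger0_norm//.
apply: le_trans (ler_wpM2l _ (cab k.+1)) _ => //.
rewrite factS natrM invfM exprS.
rewrite [leLHS](_ : _ = b * a * a ^+ k * (k.+1%:R / k.+1%:R) / k`!%:R);
  last by move: (k.+1%:R : R) (k`!%:R : R) => u v; ring.
by rewrite divff ?mulr1// pnatr_eq0.
Qed.

Lemma pseries_exp_bound_derive (c : R^nat) (a b x : R) : 0 <= a -> 0 <= b ->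
  (forall k, `|c k| <= b * a ^+ k / k`!%:R) ->
  is_derive x (1 : R) (fun y => limn (pseries c y))
    (limn (pseries (pseries_diffs c) x)).
Proof.
move=> a0 b0 cab; have cab1 := pseries_diffs_exp_bound cab.
have cab2 := pseries_diffs_exp_bound cab1.
(* The series and its first two derived series must converge at some point of modulus greater than
   [|x|]; [|x| + 1] is such a point. *)
apply: (@pseries_snd_diffs _ c (`|x| + 1)).
- exact: pseries_exp_bound_cvg cab.
- by apply: pseries_exp_bound_cvg cab1 => //; exact: mulr_ge0.
- by apply: pseries_exp_bound_cvg cab2 => //; rewrite !mulr_ge0.
- by rewrite [ltRHS]ger0_norm ?addr_ge0// ltrDl.
Qed.

Lemma pseries_at0 (c : R^nat) : limn (pseries c 0) = c 0%N.
Proof.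
apply: lim_near_cst => //; near=> n.
rewrite /pseries /series /= -[n]prednK; last by near: n.
rewrite big_nat_recl//= expr0 mulr1 big1 ?addr0// => k _.
by rewrite expr0n mulr0.
Unshelve. all: by end_near. Qed.

Lemma mxexp_exists (m : nat) (N : 'M[R]_m) :
  exists2 E : R -> 'M[R]_m, E 0 = 1%:M & forall T,
    has_deriv_on T E (fun t => N *m E t).
Proof.
pose c i j k : R := (N ^+ k) i j / k`!%:R.
(* The sum of all absolute entries dominates each row sum, whence by induction [a ^+ k] bounds every
   entry of [N ^+ k]. *)
pose a := \sum_i \sum_j `|N i j|.
have a0 : 0 <= a by apply: sumr_ge0 => i _; exact: sumr_ge0.
have N_le k i j : `|(N ^+ k) i j| <= a ^+ k.
  elim: k i j => [|k IH] i j.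
    by rewrite expr0 mxE; case: eqP => _; rewrite ?normr1 ?normr0.
  rewrite exprS mxE; apply: le_trans (ler_norm_sum _ _ _) _.
  apply: (@le_trans _ _ ((\sum_p `|N i p|) * a ^+ k)).
    by rewrite mulr_suml; apply: ler_sum => p _; rewrite normrM ler_wpM2l.
  rewrite exprS ler_wpM2r ?exprn_ge0//.
  by rewrite /a [leRHS](bigD1 i)//= lerDl sumr_ge0// => q _; exact: sumr_ge0.
have c_le i j k : `|c i j k| <= 1 * a ^+ k / k`!%:R.
  by rewrite mul1r /c normrM normfV [`|_%:R|]ger0_norm// ler_wpM2r// invr_ge0.
(* This is [E' = N E] at the level of coefficients. *)
have c_diffs i j : pseries_diffs (c i j) = fun k => \sum_p N i p * c p j k.
  apply/funext => k; rewrite /pseries_diffs /c factS natrM invfM.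
  rewrite mulrCA mulVKf ?pnatr_eq0// exprS mxE mulr_suml.
  by apply: eq_bigr => p _; rewrite mulrA.
exists (fun t => \matrix_(i, j) limn (pseries (c i j) t)).
  apply/matrixP => i j; rewrite mxE pseries_at0 /c expr0 !mxE fact0.
  by rewrite invr1 mulr1.
move=> T; apply/has_deriv_on_mxP => i j.
under eq_fun do rewrite mxE; apply: is_derive_has_deriv_on => t.
have := pseries_exp_bound_derive t a0 ler01 (c_le i j).
suff -> : limn (pseries (pseries_diffs (c i j)) t) =
    (N *m (\matrix_(p, q) limn (pseries (c p q) t))) i j by [].
apply: cvg_lim => //; rewrite mxE c_diffs.
rewrite (_ : pseries _ t = fun n => \sum_p N i p * pseries (c p j) t n).
  under eq_bigr do rewrite mxE.
  apply: cvg_big => [|p _]; first exact: add_continuous.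
  apply: (@cvgM R); first exact: cvg_cst.
  exact: (pseries_exp_bound_cvg a0 ler01 (c_le p j)).
apply/funext => n; rewrite /pseries /series /=.
under eq_bigr do rewrite mulr_suml.
rewrite exchange_big /=; apply: eq_bigr => p _.
by rewrite mulr_sumr; apply: eq_bigr => k _; rewrite mulrA.
Qed.

End MatrixExponential.

(** * Normalization of matrix identities *)

Lemma trmxD (V : nmodType) (m n : nat) (A B : 'M[V]_(m, n)) :
  (A + B)^T = A^T + B^T.
Proof. by apply/matrixP => i j; rewrite !mxE. Qed.

Lemma trmxN (V : zmodType) (m n : nat) (A : 'M[V]_(m, n)) : (- A)^T = - A^T.
Proof. by apply/matrixP => i j; rewrite !mxE. Qed.

Ltac mx_expand := rewrite ?(trmxD, trmxN, trmx0, trmx1, trmxK, trmx_mul, mulmxDl, mulmxDr,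
  mulNmx, mulmxN, mul1mx, mulmx1, mul0mx, mulmx0, mulmxA).

(* Products are expanded and then abstracted, so that entrywise the goal is
   linear in commuting scalars. *)
Ltac mx_ring := mx_expand;
  repeat match goal with |- context [?X *m ?Y] => move: (X *m Y) => ? end;
  apply/matrixP => ? ?; rewrite !mxE; ring.

(** * Initial value problems with constant coefficients *)

Section LinearODE.
Context (R : realType) (T : R) (T0 : 0 <= T).

Lemma has_deriv_on_col_mx (m1 m2 n : nat) (f f' : R -> 'M[R]_(m1, n))
    (g g' : R -> 'M[R]_(m2, n)) : has_deriv_on T f f' -> has_deriv_on T g g' ->
  has_deriv_on T (fun t => col_mx (f t) (g t)) (fun t => col_mx (f' t) (g' t)).
Proof.
move=> /has_deriv_on_mxP Df /has_deriv_on_mxP Dg; apply/has_deriv_on_mxP => i j.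
under eq_fun do rewrite mxE; under [X in has_deriv_on _ _ X]eq_fun do rewrite mxE.
by case: (fintype.split i) => k.
Qed.

(** The forcing [z] solves an autonomous linear equation itself, so the stacked pair [(z, y)] solves
    a block triangular one. The matrix exponential of that block matrix gives [y] without variation
    of constants. *)
Lemma linear_ode_forced (m k q : nat) (F : 'M[R]_m) (B : 'M[R]_(m, k))
    (N : 'M[R]_k) (z z' : R -> 'M[R]_(k, q)) (y0 : 'M[R]_(m, q)) :
  has_deriv_on T z z' -> (forall t, t \in `]0, T[ -> z' t = N *m z t) ->
  exists2 y : R -> 'M[R]_(m, q), y 0 = y0 &
    has_deriv_on T y (fun t => F *m y t + B *m z t).
Proof.
move=> Dz zN; have [E E0 /(_ T) DE] := mxexp_exists (block_mx N 0 B F).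
pose g t := E t *m col_mx (z 0) y0.
have Dg : has_deriv_on T g (fun t => block_mx N 0 B F *m g t).
  by have := has_deriv_on_mulmxr (col_mx (z 0) y0) DE; under
    [X in has_deriv_on _ _ X]eq_fun do rewrite -mulmxA.
have g0 : g 0 = col_mx (z 0) y0 by rewrite /g E0 mul1mx.
have gE t : block_mx N 0 B F *m g t =
    col_mx (N *m usubmx (g t)) (B *m usubmx (g t) + F *m dsubmx (g t)).
  by rewrite -[in LHS](vsubmxK (g t)) mul_block_col mul0mx addr0.
have zT : 0 \in `[0, T] by rewrite in_itv /= lexx.
(* The upper block and [z] satisfy the same equation with the same initial value. *)
have gz t : t \in `[0, T] -> usubmx (g t) = z t.
  move=> tT; apply/subr0_eq.
  apply: (linear_ode_zero (has_deriv_on_cstmx T N) (has_deriv_on_cstmx T 0)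
    (has_deriv_on_submx (has_deriv_on_usubmx Dg) Dz) _ zT) tT => [s sT|].
    by rewrite gE col_mxKu zN// mulmx0 addr0 mulmxBr.
  by rewrite g0 col_mxKu subrr.
exists (fun t => dsubmx (g t)); first by rewrite g0 col_mxKd.
apply: has_deriv_on_eqr (has_deriv_on_dsubmx Dg) => t tT.
by rewrite gE col_mxKd gz// addrC.
Qed.

Lemma has_deriv_on_zero (f f' : R -> R) : @has_deriv_on R R^o T f f' ->
  (forall t, t \in `[0, T] -> f t = 0) -> forall t, t \in `]0, T[ -> f' t = 0.
Proof.
move=> Df f0 t tT.
have [_ <-] := has_deriv_on_is_derive Df tT.
have : \forall s \near t, s \in `]0, T[ by apply: near_in_itvoo.
move=> tI; rewrite (_ : 0 = 'D_1 (cst 0 : R -> R^o) t); last by rewrite derive_cst.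
apply: near_eq_derive; near=> s; apply: f0.
have : s \in `]0, T[ by near: s.
exact: subset_itv_oo_cc.
Unshelve. all: by end_near. Qed.

End LinearODE.

(** * The two-point problem: existence by shooting *)

Section TwoPoint.
Context (R : realType) (T : R) (T_gt0 : 0 < T).

Definition solves_two_point (n : nat) (F S Qt H : 'M[R]_n)
    (c x0 : 'cV[R]_n) (x p : R -> 'cV[R]_n) : Prop :=
  [/\ has_deriv_on T x (fun t => F *m x t - S *m p t), x 0 = x0,
      has_deriv_on T p (fun t => - (F^T *m p t) - Qt *m x t + c)
    & p T = H *m x T].

(** The unknown is the initial value [p 0]. The residual [p T - H x T] depends on it affinely, with
    linear part [W], and uniqueness for the homogeneous problem makes [W] injective. *)
Lemma two_point_exists (n : nat) (F S Qt H : 'M[R]_n) (c x0 : 'cV[R]_n) :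
  (forall x p, solves_two_point F S Qt H 0 0 x p -> p 0 = 0) ->
  exists x p, solves_two_point F S Qt H c x0 x p.
Proof.
move=> uniq; have T0 := ltW T_gt0.
pose N := block_mx F (- S) (- Qt) (- F^T).
have NE q (g : 'M[R]_(n + n, q)) : N *m g =
    col_mx (F *m usubmx g - S *m dsubmx g) (- (F^T *m dsubmx g) - Qt *m usubmx g).
  by rewrite -[in LHS](vsubmxK g) mul_block_col !mulNmx [X in col_mx _ X]addrC.
(* A constant forcing term is [B *m z] with [z] the identity, which solves [z' = 0]. *)
have ivp q (B : 'M[R]_(n + n, q)) g0 : exists2 g, g 0 = g0 &
    has_deriv_on T g (fun t => N *m g t + B).
  have [|g g00 Dg] := linear_ode_forced T0 N B g0 (N := 0) (has_deriv_on_cstmx T 1%:M).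
    by move=> t _; rewrite mul0mx.
  exists g; first exact: g00.
  apply: has_deriv_on_eqr Dg => t _.
  by rewrite mulmx1.
(* [G *m u] is the homogeneous solution started at [x 0 = 0], [p 0 = u]; [g] is the particular
   solution with [p 0 = 0]. *)
have [G G0 DG] := ivp n 0 (col_mx 0 1%:M).
have [g g0 Dg] := ivp 1%N (col_mx 0 c) (col_mx x0 0).
pose W := dsubmx (G T) - H *m usubmx (G T).
have W_unit : W \in unitmx.
  rewrite -unitmx_tr -row_free_unit; apply/inj_row_free => v vW.
  pose u := v^T.
  have Wu : W *m u = 0 by apply: trmx_inj; rewrite trmx_mul trmxK vW trmx0.
  suff : u = 0 by move/(congr1 trmx); rewrite trmxK trmx0.
  have DGu := has_deriv_on_mulmxr u DG.
  (* A kernel vector [u] of [W] makes [G *m u] a solution of the homogeneous two-point problem,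
     whose [p 0] is [u]. *)
  have <- : dsubmx (G 0 *m u) = u by rewrite G0 mul_col_mx col_mxKd mul1mx.
  apply: (uniq (fun t => usubmx (G t *m u)) (fun t => dsubmx (G t *m u))); split.
  - apply: has_deriv_on_eqr (has_deriv_on_usubmx DGu) => t _.
    by rewrite addr0 -mulmxA NE col_mxKu.
  - by rewrite G0 mul_col_mx col_mxKu mul0mx.
  - apply: has_deriv_on_eqr (has_deriv_on_dsubmx DGu) => t _.
    by rewrite !addr0 -mulmxA NE col_mxKd.
  - rewrite -mul_usub_mx -mul_dsub_mx mulmxA; apply/subr0_eq.
    by rewrite -mulmxBl.
(* This initial value cancels the residual of [g] at [T]. *)
pose u := invmx W *m (H *m usubmx (g T) - dsubmx (g T)).
have DGu := has_deriv_on_addmx Dg (has_deriv_on_mulmxr u DG).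
pose h t := g t + G t *m u.
have hE t : N *m g t + col_mx 0 c + (N *m G t + 0) *m u = N *m h t + col_mx 0 c.
  by rewrite /h addr0 addrAC mulmxDr -[N *m G t *m u]mulmxA.
exists (fun t => usubmx (h t)), (fun t => dsubmx (h t)); split.
- apply: has_deriv_on_eqr (has_deriv_on_usubmx DGu) => t _.
  by rewrite hE NE add_col_mx col_mxKu addr0.
- by rewrite /h g0 G0 mul_col_mx add_col_mx col_mxKu mul0mx addr0.
- apply: has_deriv_on_eqr (has_deriv_on_dsubmx DGu) => t _.
  by rewrite hE NE add_col_mx col_mxKd.
- apply/subr0_eq; rewrite /h !linearD /= -mul_usub_mx -mul_dsub_mx.
  rewrite [LHS](_ : _ = W *m u - (H *m usubmx (g T) - dsubmx (g T))); last first.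
    rewrite /W; move: (u) (dsubmx (G T)) (usubmx (G T)) (usubmx (g T)) (dsubmx (g T)).
    by move=> *; mx_ring.
  by rewrite /u mulKVmx// subrr.
Qed.
End TwoPoint.

(** * Definite and semidefinite matrices *)

Section Definite.
Context (R : realType).

Lemma pdmx_unit (k : nat) (S : 'M[R]_k) : pdmx S -> S \in unitmx.
Proof.
move=> [ST S_gt0]; rewrite -row_free_unit; apply/inj_row_free => v vS.
apply/eqP; apply: contraT => v0.
have := S_gt0 v^T; rewrite trmxK vS mul0mx mxE ltxx; apply.
by apply: contra v0 => /eqP/(congr1 trmx); rewrite trmxK trmx0 => ->.
Qed.

(** By symmetry, the form of [invmx S] at [u] is the form of [S] at [invmx S *m u]. *)
Lemma pdmx_invmx (k : nat) (S : 'M[R]_k) : pdmx S -> pdmx (invmx S).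
Proof.
move=> Spd; have S_unit := pdmx_unit Spd; have [ST S_gt0] := Spd.
split=> [|u u0]; first by rewrite trmx_inv ST.
have /S_gt0 : invmx S *m u != 0.
  by apply: contra u0 => /eqP Su; rewrite -(mulKVmx S_unit u) Su mulmx0.
by rewrite trmx_mul trmx_inv ST mulmxKV// mulmxA.
Qed.

Lemma pdmx_ge0 (k : nat) (S : 'M[R]_k) (u : 'cV[R]_k) :
  pdmx S -> 0 <= (u^T *m S *m u) 0 0.
Proof.
move=> [_ S_gt0]; have [->|/S_gt0/ltW//] := eqVneq u 0.
by rewrite mulmx0 mxE.
Qed.

Lemma pdmx_eq0 (k : nat) (S : 'M[R]_k) (u : 'cV[R]_k) :
  pdmx S -> (u^T *m S *m u) 0 0 = 0 -> u = 0.
Proof.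
move=> [_ S_gt0] Su0; apply/eqP/contraT => /S_gt0; by rewrite Su0 ltxx.
Qed.

Lemma psdmx_congr (k l : nat) (S : 'M[R]_k) (C : 'M[R]_(k, l)) :
  psdmx S -> psdmx (C^T *m S *m C).
Proof.
move=> [ST S_ge0]; split=> [|u]; first by rewrite !trmx_mul trmxK ST mulmxA.
by have := S_ge0 (C *m u); rewrite trmx_mul !mulmxA.
Qed.

End Definite.

(** * Symmetry of Riccati solutions *)

(** The difference [D = P^T - P] satisfies the linear equation [D' = (P^T S - F^T) D + D (S P - F)]
    and vanishes at [T]. *)
Lemma riccati_sym (R : realType) (T : R) (n : nat) (F S Q P_end : 'M[R]_n)
    (P : R -> 'M[R]_n) :
  0 <= T -> S^T = S -> Q^T = Q -> P_end^T = P_end ->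
  has_deriv_on T P (fun t =>
    - (F^T *m P t + P t *m F - P t *m S *m P t - Q)) -> P T = P_end ->
  forall t, t \in `[0, T] -> (P t)^T = P t.
Proof.
move=> T0 ST QT P_endT DP PT t tT; apply/subr0_eq.
have TT : T \in `[0, T] by rewrite in_itv /= lexx andbT.
have DPT := has_deriv_on_trmx DP.
pose L1 s := (P s)^T *m S - F^T; pose L2 s := S *m P s - F.
have DL1 : has_deriv_on T L1 _ := has_deriv_on_submx
  (has_deriv_on_mulmxr S DPT) (has_deriv_on_cstmx T F^T).
have DL2 : has_deriv_on T L2 _ := has_deriv_on_submx
  (has_deriv_on_mulmxl S DP) (has_deriv_on_cstmx T F).
apply: (linear_ode_zero DL1 DL2 (has_deriv_on_submx DPT DP) _ TT) tT => [s _|].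
  by rewrite /L1 /L2; mx_expand; rewrite ST QT; mx_ring.
by rewrite PT P_endT subrr.
Qed.

(** * Uniqueness for the two-point problem *)

Section TwoPointUniqueness.
Context (R : realType) (T : R) (T_gt0 : 0 < T) (n r : nat).
Context (F Qt H R2i : 'M[R]_n) (B : 'M[R]_(n, r)) (R1i : 'M[R]_r).
Context (Qt_psd : psdmx Qt) (H_psd : psdmx H) (R1i_pd : pdmx R1i) (R2i_pd : pdmx R2i).
Context (P : R -> 'M[R]_n).
Context (P_deriv : has_deriv_on T P (fun t =>
  - (F^T *m P t + P t *m F - P t *m R2i *m P t - Qt))) (P_T : P T = - H).

Let T0 : 0 <= T := ltW T_gt0.
Let zT : 0 \in `[0, T]. Proof. by rewrite in_itv /= lexx. Qed.
Let TT : T \in `[0, T]. Proof. by rewrite in_itv /= lexx andbT. Qed.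

Let b := B *m R1i *m B^T.

Lemma two_point_uniq (x p : R -> 'cV[R]_n) :
  solves_two_point T F (b - R2i) Qt H 0 0 x p ->
  forall t, t \in `[0, T] -> x t = 0 /\ p t = 0.
Proof.
move=> [Dx x0 Dp pT].
have R1iT : R1i^T = R1i by case: R1i_pd.
have R2iT : R2i^T = R2i by case: R2i_pd.
have QtT : Qt^T = Qt by case: Qt_psd.
have HT : H^T = H by case: H_psd.
pose N := block_mx F (- (b - R2i)) (- Qt) (- F^T).
have Dz := has_deriv_on_col_mx Dx Dp.
(* The block row [row_mx 0 R2i] reads [p] off the stacked forcing [(x, p)]. *)
have [|d d0 Dd] := linear_ode_forced T0 F (row_mx 0 R2i) 0 (N := N) Dz.
  by move=> t _; rewrite mul_block_col !mulNmx addr0 [X in col_mx _ X]addrC.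
have {}Dd : has_deriv_on T d (fun t => F *m d t + R2i *m p t).
  by apply: has_deriv_on_eqr Dd => t _; rewrite mul_row_col mul0mx add0r.
pose y t := x t - d t; pose f t := p t + P t *m d t.
(* 2 d.p is spelled d^T p + p^T d so that V' is a sum of squares without
   transposing any 1 x 1 matrix. *)
pose V t := - ((x t)^T *m p t) + (d t)^T *m p t + (p t)^T *m d t
  + (d t)^T *m P t *m d t.
have PT t : t \in `[0, T] -> (P t)^T = P t.
  by apply: (riccati_sym T0 R2iT QtT _ P_deriv P_T); rewrite trmxN HT.
have DxT := has_deriv_on_trmx Dx; have DpT := has_deriv_on_trmx Dp.
have DdT := has_deriv_on_trmx Dd.
pose V' t := (y t)^T *m Qt *m y t + (B^T *m p t)^T *m R1i *m (B^T *m p t)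
  + (f t)^T *m R2i *m f t.
have DV : has_deriv_on T V V'.
  have := has_deriv_on_addmx (has_deriv_on_addmx (has_deriv_on_addmx
    (has_deriv_on_oppmx (has_deriv_on_mulmx DxT Dp)) (has_deriv_on_mulmx DdT Dp))
    (has_deriv_on_mulmx DpT Dd))
    (has_deriv_on_mulmx (has_deriv_on_mulmx DdT P_deriv) Dd).
  apply: has_deriv_on_eqr => t tT; rewrite /V' /y /f /b; mx_expand.
  by rewrite (PT t tT) R1iT R2iT QtT; mx_ring.
have DV0 : @has_deriv_on R R^o T (fun t => V t 0 0) (fun t => V' t 0 0).
  by have /has_deriv_on_mxP := DV; apply.
have R1_ge0 t : 0 <= ((B^T *m p t)^T *m R1i *m (B^T *m p t)) 0 0 by exact: pdmx_ge0.
have R2_ge0 t : 0 <= ((f t)^T *m R2i *m f t) 0 0 by exact: pdmx_ge0.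
have Q_ge0 t : 0 <= ((y t)^T *m Qt *m y t) 0 0 by case: Qt_psd.
have V'E t : V' t 0 0 = ((y t)^T *m Qt *m y t) 0 0
    + ((B^T *m p t)^T *m R1i *m (B^T *m p t)) 0 0 + ((f t)^T *m R2i *m f t) 0 0.
  by rewrite /V' mxE [X in X + _]mxE.
(* [V] is nondecreasing, starts at 0 and ends at minus the [H]-form of [y T], so it vanishes on all
   of [0, T]. *)
have V0 t : t \in `[0, T] -> V t 0 0 = 0.
  move=> tT; have V'_ge0 s : s \in `]0, T[ -> 0 <= V' s 0 0.
    by move=> _; rewrite V'E !addr_ge0.
  have Vmono := has_deriv_on_ge0_le DV0 V'_ge0.
  have /andP[t0 tT'] : (0 <= t) && (t <= T) by move: tT; rewrite in_itv.
  have V_0 : V 0 = 0 by rewrite /V x0 d0 trmx0 !(mul0mx, mulmx0) oppr0 !addr0.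
  have V_T : V T 0 0 <= 0.
    have -> : V T = - ((y T)^T *m H *m y T).
      by rewrite /V /y pT P_T; mx_expand; rewrite HT; mx_ring.
    by rewrite mxE oppr_le0; case: H_psd.
  apply/eqP; rewrite eq_le (le_trans (Vmono _ _ tT TT tT'))//.
  by have := Vmono _ _ zT tT t0; rewrite V_0 mxE.
have V'0 := has_deriv_on_zero DV0 V0.
have zero_terms t : t \in `]0, T[ -> B^T *m p t = 0 /\ f t = 0.
  move=> tT; have := V'0 t tT; rewrite V'E => /eqP.
  rewrite paddr_eq0 ?addr_ge0// => /andP[]; rewrite paddr_eq0// => /andP[_].
  by move=> /eqP/(pdmx_eq0 R1i_pd) ? /eqP/(pdmx_eq0 R2i_pd).
(* [Qt] is only semidefinite, so [y = 0] is drawn from the equations instead: [b p = 0] and the two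
   terms [R2i p] cancel, leaving [y' = F y] with [y 0 = 0]. *)
have y0 t : t \in `[0, T] -> y t = 0.
  apply: (linear_ode_zero (has_deriv_on_cstmx T F) (has_deriv_on_cstmx T 0)
    (has_deriv_on_submx Dx Dd) _ zT) => [s sT|]; last by rewrite x0 d0 subrr.
  have [Bp _] := zero_terms s sT.
  have bp : b *m p s = 0 by rewrite /b -mulmxA Bp mulmx0.
  by rewrite mulmxBl bp; mx_ring.
have p_eq t : t \in `]0, T[ -> p t = - (P t *m x t).
  move=> tT; have [_ /eqP] := zero_terms t tT; rewrite addr_eq0 => /eqP ->.
  by rewrite (subr0_eq (y0 t (subset_itv_oo_cc tT))).
(* From [d = x] and [f = 0] follows [p = - P x], which closes the equation of [x] as
   [x' = (F - R2i P) x]. *)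
have xz t : t \in `[0, T] -> x t = 0.
  apply: (linear_ode_zero (has_deriv_on_submx (has_deriv_on_cstmx T F)
    (has_deriv_on_mulmxl R2i P_deriv)) (has_deriv_on_cstmx T 0) Dx _ zT) => // s sT.
  have [Bp _] := zero_terms s sT.
  have bp : b *m p s = 0 by rewrite /b -mulmxA Bp mulmx0.
  by rewrite mulmxBl bp p_eq//; mx_ring.
move=> t tT; split; first exact: xz.
(* With [x = 0] there remains [p' = - F^T p] and [p T = 0]. *)
apply: (linear_ode_zero (has_deriv_on_cstmx T (- F^T)) (has_deriv_on_cstmx T 0)
  Dp _ TT) tT => [s sT|]; last by rewrite pT xz ?mulmx0.
by rewrite xz ?(subset_itv_oo_cc sT)//; mx_ring.
Qed.

End TwoPointUniqueness.

(** * Equivalence of the full system with the two-point problem *)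

Section Reduction.
Context (R : realType) (n r : nat) (d : coefs R n r) (T : R) (T_gt0 : 0 < T).
Context (Q_psd : psdmx (coefQ d)) (H_psd : psdmx (coefH d)).
Context (R1_pd : pdmx (coefR1 d)) (R2_pd : pdmx (coefR2 d)).
Context (P K : R -> 'M[R]_n) (P_sol : solves_P d T P) (K_sol : solves_K d T K).

Local Notation A := (coefA d).
Local Notation G := (coefG d).
Local Notation Gamma := (coefGamma d).
(* Unqualified, [coefB] is the lemma on coefficients of polynomial differences. *)
Local Notation B := (Defs.coefB d).
Local Notation Q := (coefQ d).
Local Notation H := (coefH d).
Local Notation R1i := (invmx (coefR1 d)).
Local Notation R2i := (invmx (coefR2 d)).
Local Notation b := (B *m R1i *m B^T).
Local Notation Qt := ((1%:M - Gamma)^T *m Q *m (1%:M - Gamma)).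
Local Notation reduced :=
  (solves_two_point T (A + G) (b - R2i) Qt H (etabar d) (coefx0 d)).

Let T0 : 0 <= T := ltW T_gt0.
Let zT : 0 \in `[0, T]. Proof. by rewrite in_itv /= lexx. Qed.
Let TT : T \in `[0, T]. Proof. by rewrite in_itv /= lexx andbT. Qed.
Let R1iT : R1i^T = R1i. Proof. by case: (pdmx_invmx R1_pd). Qed.
Let R2iT : R2i^T = R2i. Proof. by case: (pdmx_invmx R2_pd). Qed.
Let QT : Q^T = Q. Proof. by case: Q_psd. Qed.
Let HT : H^T = H. Proof. by case: H_psd. Qed.

Let P_sym t : t \in `[0, T] -> (P t)^T = P t.
Proof.
have [QtT _] := psdmx_congr (1%:M - Gamma) Q_psd.
by case: P_sol => DP PT; apply: (riccati_sym T0 R2iT QtT _ DP PT); rewrite trmxN HT.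
Qed.

Let K_sym t : t \in `[0, T] -> (K t)^T = K t.
Proof.
have bT : b^T = b by rewrite !trmx_mul trmxK R1iT mulmxA.
(* The equation of [K] fits [riccati_sym] with quadratic coefficient [b] and constant term [- Q]. *)
have QNT : (- Q)^T = - Q by rewrite trmxN QT.
case: K_sol => DK KT; apply: (riccati_sym T0 bT QNT HT (F := A) _ KT).
by apply: has_deriv_on_eqr DK => s _; mx_ring.
Qed.

Lemma solves_star_reduced x l s phi v : solves_star d T P K x l s phi v ->
  reduced x v /\ forall t, t \in `[0, T] ->
    [/\ l t = 0, s t = - (P t *m x t + v t) & phi t = v t - K t *m x t].
Proof.
move=> [[Dx x0] [Dl l0] [Ds sT] [Dphi phiT] [Dv vT]].
have [DP PT] := P_sol; have [DK KT] := K_sol.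
pose L t := A + Gbar d P t.
have DL : has_deriv_on T L _ := has_deriv_on_addmx (has_deriv_on_cstmx T A)
  (has_deriv_on_submx (has_deriv_on_cstmx T G) (has_deriv_on_mulmxl R2i DP)).
have D0 := has_deriv_on_cstmx T (0 : 'M[R]_1).
(* The sum [w = v + P x + s] satisfies [w' = - L^T w]: the terms in [b] and [etabar] cancel, and the
   equation of [P] absorbs [Psi - Q]. *)
have w0 t : t \in `[0, T] -> v t + P t *m x t + s t = 0.
  apply: (linear_ode_zero (has_deriv_on_oppmx (has_deriv_on_trmx DL)) D0
    (has_deriv_on_addmx (has_deriv_on_addmx Dv (has_deriv_on_mulmx DP Dx)) Ds)
    _ TT) => [u uT|]; last by rewrite vT PT sT addr0 mulNmx subrr.
  have uT' : u \in `[0, T] by exact: subset_itv_oo_cc uT.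
  rewrite /L /Abar /Gbar /Psi; mx_expand; rewrite (P_sym uT') R2iT.
  by move: (etabar d) => ?; mx_ring.
have s_eq t : t \in `[0, T] -> s t = - (P t *m x t + v t).
  by move=> tT; apply/eqP; rewrite -addr_eq0 addrC [_ + v t]addrC; apply/eqP/w0.
(* Now [v + P x + s = 0] removes the forcing of [l], leaving [l' = L l]. *)
have lz t : t \in `[0, T] -> l t = 0.
  apply: (linear_ode_zero DL D0 Dl _ zT) => // u uT.
  by rewrite s_eq ?(subset_itv_oo_cc uT)// /L; mx_ring.
(* After substituting [l = 0] and [s = - (P x + v)], the combination [u = K x + phi - v] satisfies
   [u' = - A^T u]. *)
have u0 t : t \in `[0, T] -> K t *m x t + phi t - v t = 0.
  apply: (linear_ode_zero (has_deriv_on_cstmx T (- A^T)) D0 (has_deriv_on_submx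
    (has_deriv_on_addmx (has_deriv_on_mulmx DK Dx) Dphi) Dv) _ TT) => [u uT|].
    have uT' : u \in `[0, T] by exact: subset_itv_oo_cc uT.
    rewrite (lz u uT') (s_eq u uT') /Abar /Gbar /Psi; mx_expand.
    rewrite (P_sym uT') (K_sym uT') R1iT R2iT.
    by move: (etabar d) => ?; mx_ring.
  by rewrite KT phiT vT addr0 subrr.
have phi_eq t : t \in `[0, T] -> phi t = v t - K t *m x t.
  by move=> tT; rewrite -(subr0_eq (u0 t tT)) addrAC subrr add0r.
split=> [|t tT]; last by split; [exact: lz|exact: s_eq|exact: phi_eq].
split.
- apply: has_deriv_on_eqr Dx => t tT.
  by rewrite lz// s_eq// phi_eq// /Abar /Gbar; mx_ring.
- exact: x0.
- apply: has_deriv_on_eqr Dv => t tT.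
  rewrite s_eq// /Gbar /Psi; mx_expand; rewrite P_sym// R2iT.
  by move: (etabar d) => ?; mx_ring.
- exact: vT.
Qed.

(** The converse direction, which carries existence from the two-point problem back to the full
    system. *)
Lemma reduced_solves_star x v : reduced x v ->
  solves_star d T P K x (fun=> 0) (fun t => - (P t *m x t + v t))
    (fun t => v t - K t *m x t) v.
Proof.
move=> [Dx x0 Dv vT]; have [DP PT] := P_sol; have [DK KT] := K_sol.
split; split.
- apply: has_deriv_on_eqr Dx => t tT.
  by rewrite /Abar /Gbar; mx_ring.
- exact: x0.
- apply: has_deriv_on_eqr (has_deriv_on_cstmx T 0) => t tT.
  by mx_ring.
- by [].
- apply: has_deriv_on_eqr (has_deriv_on_oppmx
    (has_deriv_on_addmx (has_deriv_on_mulmx DP Dx) Dv)) => t tT.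
  rewrite /Gbar; mx_expand; rewrite P_sym// R2iT.
  by move: (etabar d) => ?; mx_ring.
- by rewrite PT vT mulNmx addNr oppr0.
- apply: has_deriv_on_eqr (has_deriv_on_submx Dv (has_deriv_on_mulmx DK Dx)) => t tT.
  rewrite /Abar /Gbar /Psi; mx_expand; rewrite P_sym// K_sym// R1iT R2iT.
  by move: (etabar d) => ?; mx_ring.
- by rewrite KT vT subrr.
- apply: has_deriv_on_eqr Dv => t tT.
  rewrite /Gbar /Psi; mx_expand; rewrite P_sym// R2iT.
  by move: (etabar d) => ?; mx_ring.
- exact: vT.
Qed.

(** For uniqueness, the difference of two solutions has [(x, v)] solving the homogeneous two-point
    problem, and [x], [v] determine the other three components. *)
Lemma A3_of_P_K : A3 d T P K.
Proof.
have [DP PT] := P_sol.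
have uniq := two_point_uniq T_gt0 (psdmx_congr (1%:M - Gamma) Q_psd) H_psd
  (pdmx_invmx R1_pd) (pdmx_invmx R2_pd) (B := B) DP PT.
split.
  have [|x [p xp]] := two_point_exists T_gt0 (F := A + G) (S := b - R2i)
      (Qt := Qt) (H := H) (etabar d) (coefx0 d).
    by move=> x p /uniq/(_ 0 zT)[].
  by exists x, (fun=> 0), (fun t => - (P t *m x t + p t)),
    (fun t => p t - K t *m x t), p; exact: reduced_solves_star.
move=> x l s phi v x' l' s' phi' v' /solves_star_reduced[[Dx x0 Dv vT] E].
move=> /solves_star_reduced[[Dx' x0' Dv' vT'] E'] t tT.
have xv : solves_two_point T (A + G) (b - R2i) Qt H 0 0
    (fun t => x t - x' t) (fun t => v t - v' t).
  split.
  - by apply: has_deriv_on_eqr (has_deriv_on_submx Dx Dx') => u _; mx_ring.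
  - by rewrite x0 x0' subrr.
  - apply: has_deriv_on_eqr (has_deriv_on_submx Dv Dv') => u _.
    by move: (etabar d) => ?; mx_ring.
  - by rewrite vT vT' mulmxBr.
have [/subr0_eq xx /subr0_eq vv] := uniq _ _ xv t tT.
have [-> -> ->] := E t tT; have [-> -> ->] := E' t tT.
by rewrite xx vv.
Qed.

End Reduction.

Theorem proposition2p4 (R : realType) (n r : nat) (d : coefs R n r) (T : R)
    (T_gt0 : 0 < T)
    (Q_psd : psdmx (coefQ d)) (H_psd : psdmx (coefH d))
    (R1_pd : pdmx (coefR1 d)) (R2_pd : pdmx (coefR2 d))
    (P K : R -> 'M[R]_n)
    (P_sol : solves_P d T P) (K_sol : solves_K d T K) :
  ((exists Y : R -> 'M[R]_(n + n + n, n + n), solves_Y d T P K Y) ->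
     A3 d T P K) /\
  (etabar d = 0 ->
   (exists Z : R -> 'M[R]_(n + n, n + n + n), solves_Z d T P K Z) ->
     A3 d T P K).
Proof. by split=> *; exact: A3_of_P_K. Qed.
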